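(* Let $G=(V,E)$ be a finite directed graph (possibly cyclic). A finite functional causal model on $G$ is inconsistent if and only if its average number of solutions is zero, $\overline N=0$.
   Context: Graphs. A directed graph $G=(V,E)$ has a finite vertex set $V$ and edges $E\subseteq V\times V$, $(v,w)$ being an edge from $v$ to $w$. $\mathrm{Pa}(v)=\{w:(w,v)\in E\}$, $\mathrm{Ch}(v)=\{w:(v,w)\in E\}$, $\mathrm{out}(v)=\{(v,w)\in E\}$. Finite functional causal model (fCM) on $G$. To each $v\in V$ assign: a random variable $X_v$ with values $x_v$ in a non-empty finite set $\mathcal X_v$; an error variable $U_v$ with values $u_v$ in a finite set $\mathcal U_v$ with probability distribution $p^v$ on $\mathcal U_v$; a function $f^v:\prod_{w\in \mathrm{Pa}(v)}\mathcal X_w\times\mathcal U_v\to\mathcal X_v$. If $G$ is acyclic, its distribution is $P_{\mathrm{acyc}}(x)_G=\sum_u\prod_{v\in V}p^v(u_v)\,\delta_{x_v,f^v(x_{\mathrm{Pa}(v)},u_v)}$ for $x=\{x_v\}_{v\in V}$, the sum being over all $u=\{u_v\in\mathcal U_v\}_{v\in V}$. Number of solutions. For $u=\{u_v\in\mathcal U_v\}_{v\in V}$, $N(u)=\sum_{x}\prod_{v\in V}\delta_{f^v(x_{\mathrm{Pa}(v)},u_v),x_v}$ (sum over all $x=\{x_v\in\mathcal X_v\}_{v\in V}$). The average number of solutions is $\overline N=\sum_u N(u)\prod_{v\in V}p^v(u_v)$. Classical post-selected teleportation protocol on a finite set $\mathcal X_A=\mathcal X_C$: a finite set $\mathcal X_B$,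 a function $g:\mathcal X_A\times\mathcal X_B\times\mathcal X_C\to\{0,1\}$ and probability distributions $q_B$ on $\mathcal X_B$, $q_C$ on $\mathcal X_C$ such that for all probability distributions $p^A$ on $\mathcal X_A$ and all $c\in\mathcal X_C$, $\sum_{a,b}p^A(a)\,\delta_{g(a,b,c),1}\,q_B(b)\,q_C(c)=p_{\mathrm{tele}}\,p^A(c)$, where $p_{\mathrm{tele}}\in(0,1]$ (independent of $p^A$) is the success probability. Teleportation graphs. The family $\mathcal G_{\mathrm{tele}}(G)$ consists of all graphs $G_{\mathrm{t}}$ obtained thus: choose $S\subseteq V$ (''split vertices'') such that $(V,E')$ with $E'=E\setminus\bigcup_{v\in S}\mathrm{out}(v)$ is acyclic. The vertices of $G_{\mathrm t}$ are $V\cup\{R_v\}_{v\in S}\cup\{T_v\}_{v\in S}$ with new vertices $R_v$ (pre-selection) and $T_v$ (post-selection). The edges are $E'\cup\{(v,T_v),(R_v,T_v)\}_{v\in S}\cup\{(R_v,w): v\in S,\ w\in\mathrm{Ch}(v)\text{ in }G\}$. All such $G_{\mathrm t}$ are acyclic. Teleportation models. Given an fCM on $G$ and $G_{\mathrm t}\in\mathcal G_{\mathrm{tele}}(G)$, a classical teleportation model on $G_{\mathrm t}$ is an fCM in which: for each $v\in S$, $T_v$ takes values $t_v\in\{0,1\}$, $R_v$ takes values $r_v\in\mathcal X_v$ and equals its error variable, and the function $f^{T_v}$ with the error distributions $p^{T_v},p^{R_v}$ form a classical post-selected teleportation protocol ($g=f^{T_v}$ with arguments the value of $v$, the error of $T_v$,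 and the value of $R_v$; $q_B=p^{T_v}$, $q_C=p^{R_v}$); every $w\in V$ keeps the same sets, error variable and function as in the fCM on $G$, where $r_v$ replaces $x_v$ as an input for each $v\in S\cap \mathrm{Pa}(w)$ (parents in $G$). Inconsistency. Given a teleportation model derived from the fCM on $G$, on a teleportation graph $G_{\mathrm t}$, let $P_{\mathrm{succ}}=P_{\mathrm{acyc}}(\{t_v=1\}_{v\in S})_{G_{\mathrm t}}$. The fCM on $G$ is called inconsistent if $P_{\mathrm{succ}}=0$ (this does not depend on the choice of teleportation graph and teleportation model). *)

(* Defs.v *)
(* MathComp world. *)
From HB Require Import structures.
From mathcomp Require Import all_boot all_order all_algebra.
Set Implicit Arguments.
Unset Strict Implicit.
Unset Printing Implicit Defensive.
Import Order.TTheory GRing.Theory Num.Theory.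
Local Open Scope ring_scope.

Definition is_distr (R : realFieldType) (T : finType) (p : T -> R) : Prop :=
  (forall t, 0 <= p t) /\ \sum_t p t = 1.

(** A directed graph on [V] is a relation [E : rel V]; self-loops are allowed,
    and [E v w] is an edge from [v] to [w]. *)

(* [cycle E [:: v]] is [E v v], so a self-loop counts as a cycle. *)
Definition acyclic (V : finType) (E : rel V) : Prop :=
  forall c : seq V, cycle E c -> c = [::].

Definition parent (V : finType) (E : rel V) (v : V) := {w : V | E w v}.

Record fcm (R : realFieldType) (V : finType) (E : rel V) := FCM {
  obs : V -> finType;
  obs_gt0 : forall v, (0 < #|obs v|)%N;
  err : V -> finType;
  errp : forall v, err v -> R;
  errp_distr : forall v, is_distr (@errp v);
  fn : forall v, {dffun forall w : parent E v, obs (val w)} -> err v -> obs v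
}.

Section Model.
Variables (R : realFieldType) (V : finType) (E : rel V) (M : fcm R E).

Definition assignment := {dffun forall v, obs M v}.
Definition errors := {dffun forall v, err M v}.

Definition restrict_pa (x : assignment) (v : V) :
    {dffun forall w : parent E v, obs M (val w)} :=
  [ffun w : parent E v => x (val w)].

(* The formula makes sense on any graph; it is a probability distribution
   when [E] is acyclic, which is the only case in which it is used. *)
Definition acyc_prob (x : assignment) : R :=
  \sum_(u : errors)
    \prod_(v : V) (errp (u v) * (x v == fn (restrict_pa x v) (u v))%:R).

Definition nb_solutions (u : errors) : nat :=
  \sum_(x : assignment) \prod_(v : V) (fn (restrict_pa x v) (u v) == x v).

Definition avg_solutions : R :=
  \sum_(u : errors) (nb_solutions u)%:R * \prod_(v : V) errp (u v).

End Model.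

(** Classical post-selected teleportation protocol on [X] (= X_A = X_C). *)
Record tele_protocol (R : realFieldType) (X : finType) := TeleProtocol {
  resource : finType; (* X_B *)
  postsel : X -> resource -> X -> bool; (* g(a, b, c) *)
  qB : resource -> R;
  qC : X -> R;
  ptele : R;
  qB_distr : is_distr qB;
  qC_distr : is_distr qC;
  ptele_itv : 0 < ptele <= 1;
  teleportP : forall pA : X -> R, is_distr pA -> forall c : X,
    \sum_(a : X) \sum_(b : resource)
      pA a * (postsel a b c == true)%:R * qB b * qC c = ptele * pA c
}.

(* E' : the outgoing edges of split vertices are removed. *)
Definition cut_edge (V : finType) (E : rel V) (S : {set V}) : rel V :=
  fun v w => E v w && (v \notin S).

Definition split_vertex (V : finType) (S : {set V}) := {v : V | v \in S}.

Definition tele_vertex (V : finType) (S : {set V}) : finType :=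
  (V + (split_vertex S + split_vertex S))%type.

(* Original vertices, pre-selection vertices R_v, post-selection vertices T_v. *)
Notation Orig v := (inl v) (only parsing).
Notation Pre s := (inr (inl s)) (only parsing).
Notation Post s := (inr (inr s)) (only parsing).

Definition tele_edge (V : finType) (E : rel V) (S : {set V}) :
    rel (tele_vertex S) :=
  fun a b => match a, b with
  | Orig v, Orig w => cut_edge E S v w
  | Orig v, Post s => v == val s
  | Pre s, Post s' => s == s'
  | Pre s, Orig w => E (val s) w
  | _, _ => false
  end.

Lemma tele_edge_acyclic (V : finType) (E : rel V) (S : {set V}) :
  acyclic (cut_edge E S) -> acyclic (@tele_edge V E S).
Proof.
move=> acE c cyc.
have orig a : a \in c -> exists v, a = Orig v.
  move=> ac; have := next_cycle cyc ac; have := prev_cycle cyc ac.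
  by case: a {ac} => [v|[s|s]]; [exists v | case: prev => [?|[?|?]] |].
have [d def_c] : exists d : seq V, c = [seq Orig v | v <- d].
  elim: c orig {cyc} => [|a c IHc] orig; first by exists [::].
  have [v ->] := orig a (mem_head a c).
  have [|d ->] := IHc; last by exists (v :: d).
  by move=> b bc; apply: orig; rewrite inE bc orbT.
have /acE d0 : cycle (cut_edge E S) d by move: cyc; rewrite def_c cycle_map.
by rewrite def_c d0.
Qed.

(** A teleportation model derived from [M]: a set of split vertices, i.e. a
    teleportation graph, together with a protocol for each split vertex.  The
    fCM on the teleportation graph that these data determine is [tele_fcm]. *)
Record tele_model (R : realFieldType) (V : finType) (E : rel V)
    (M : fcm R E) := TeleModel {
  splits : {set V};
  splits_acyclic : acyclic (cut_edge E splits);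
  protocol : forall s : split_vertex splits, tele_protocol R (obs M (val s))
}.

Section TeleFCM.
Variables (R : realFieldType) (V : finType) (E : rel V) (M : fcm R E).
Variable T : tele_model M.
Let S := splits T.
Let Et := @tele_edge V E S.

Definition tele_obs (a : tele_vertex S) : finType :=
  match a with
  | Orig v => obs M v
  | Pre s => obs M (val s)
  | Post s => bool
  end.

Definition tele_err (a : tele_vertex S) : finType :=
  match a with
  | Orig v => err M v
  | Pre s => obs M (val s)
  | Post s => resource (protocol s)
  end.

Definition tele_errp (a : tele_vertex S) : tele_err a -> R :=
  match a with
  | Orig v => @errp _ _ _ M v
  | Pre s => @qC _ _ (protocol s)
  | Post s => @qB _ _ (protocol s)
  end.

Definition tele_pa (a : tele_vertex S) :=
  {dffun forall b : parent Et a, tele_obs (val b)}.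

Lemma tele_edge_orig v w : E w v -> w \notin S -> Et (Orig w) (Orig v).
Proof. by move=> Ewv wS; apply/andP. Qed.

Lemma tele_edge_post s : Et (Orig (val s)) (Post s).
Proof. exact: eqxx. Qed.

Lemma tele_edge_pre_post s : Et (Pre s) (Post s).
Proof. exact: eqxx. Qed.

(* The value fed to [v] for its original parent [w]: that of R_w when [w] is
   split, and that of [w] itself otherwise. *)
Definition tele_input (v : V) (y : tele_pa (Orig v)) (w : parent E v) :
    obs M (val w) :=
  match boolP (val w \in S) with
  | AltTrue wS =>
      y (exist _ (Pre (exist _ (val w) wS) : tele_vertex S) (valP w))
  | AltFalse wS =>
      y (exist _ (Orig (val w) : tele_vertex S) (tele_edge_orig (valP w) wS))
  end.

Definition tele_fn (a : tele_vertex S) :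
    tele_pa a -> tele_err a -> tele_obs a :=
  match a return tele_pa a -> tele_err a -> tele_obs a with
  | Orig v => fun y u => fn [ffun w : parent E v => tele_input y w] u
  | Pre s => fun _ u => u
  | Post s => fun y u =>
      postsel (y (exist _ (Orig (val s) : tele_vertex S) (tele_edge_post s))) u
              (y (exist _ (Pre s : tele_vertex S) (tele_edge_pre_post s)))
  end.

Lemma tele_obs_gt0 a : (0 < #|tele_obs a|)%N.
Proof.
case: a => [v|[s|s]] /=; try exact: obs_gt0.
by rewrite card_bool.
Qed.

Lemma tele_errp_distr a : is_distr (@tele_errp a).
Proof.
case: a => [v|[s|s]] /=.
- exact: errp_distr.
- exact: qC_distr.
- exact: qB_distr.
Qed.

Definition tele_fcm : fcm R Et :=
  FCM tele_obs_gt0 tele_errp_distr tele_fn.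

Definition success_prob : R :=
  \sum_(x : assignment tele_fcm |
         [forall s : split_vertex S, x (Post s) == true]) acyc_prob x.

End TeleFCM.

(* Inconsistency of [M], tested on the teleportation model [T]. *)
Definition inconsistent (R : realFieldType) (V : finType) (E : rel V)
    (M : fcm R E) (T : tele_model M) : Prop :=
  success_prob T = 0.
Arguments inconsistent {R V E} M T.

(** Every fCM has a teleportation model: split all vertices and post-select on
    equality with a uniform pre-selection. *)
Lemma uniform_protocol (R : realFieldType) (X : finType) :
  (0 < #|X|)%N -> tele_protocol R X.
Proof.
move=> X_gt0.
have X0 : (#|X|%:R : R) != 0 by rewrite pnatr_eq0 -lt0n.
apply: (@TeleProtocol R X unit (fun a _ c => a == c) (fun=> 1)
          (fun=> #|X|%:R^-1) #|X|%:R^-1).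
- by split=> [//|]; rewrite sumr_const card_unit.
- split=> [_|]; first by rewrite invr_ge0 ler0n.
  by rewrite sumr_const -[LHS]mulr_natl divff.
- by rewrite invr_gt0 ltr0n X_gt0 invf_le1 ?ltr0n // ler1n.
- move=> pA _ c; rewrite (bigD1 c) //= [X in _ + X]big1 => [|a /negPf ac].
    by rewrite sumr_const card_unit mulr1n !eqxx addr0 !mulr1 mulrC.
  by rewrite big1 // => b _; rewrite ac mulr0 !mul0r.
Qed.

Lemma tele_model_inhabited (R : realFieldType) (V : finType) (E : rel V)
  (M : fcm R E) : inhabited (tele_model M).
Proof.
constructor; apply: (@TeleModel R V E M [set: V]).
- case=> [//|v c] /=; rewrite rcons_path => /andP[_].
  by rewrite /cut_edge inE andbF.
- by move=> s; apply: uniform_protocol; apply: obs_gt0.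
Qed.

(* Main.v *)
(** All the quantities involved are sums of products of nonnegative terms, so
    only their supports matter.  Applied to a point mass at [a], the
    teleportation identity shows that a protocol only succeeds with positive
    probability when [a = c], and that it does so for every value [a].  Hence in
    a successful run of positive probability of the teleportation model each
    [R_v] carries the same value as [v], so the run restricts to a solution of
    positive probability of the original model; conversely, every such solution
    extends to a successful run. *)
Require Import Defs.
From mathcomp Require Import all_boot all_order all_algebra.
Import Order.TTheory GRing.Theory Num.Theory.
Local Open Scope ring_scope.

Section Protocol.
Context {R : realFieldType} {X : finType} (P : tele_protocol R X).

Lemma is_distr_point (a : X) : is_distr (fun a' => (a' == a)%:R : R).
Proof.
split=> [a'|]; first exact: ler0n.
by rewrite (bigD1 a) //= eqxx big1 ?addr0 // => a' /negPf->.
Qed.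

Lemma teleport_point (a c : X) :
  \sum_(b : resource P) (postsel a b c)%:R * qB b * qC P c =
  ptele P * (c == a)%:R.
Proof.
rewrite -(@teleportP _ _ P _ (is_distr_point a) c) (bigD1 a) //=.
rewrite [X in _ = _ + X]big1 => [|a' /negPf->].
  by rewrite addr0; apply: eq_bigr => b _; rewrite eqxx mul1r eqb_id.
by rewrite big1 // => b _; rewrite !mul0r.
Qed.

(** Off the diagonal the sum in [teleport_point] vanishes. Its terms are nonnegative, so each of
    them is zero, and nonzero weights leave only [postsel] to vanish. *)
Lemma postsel_eq (a c : X) (b : resource P) :
  postsel a b c -> qB b != 0 -> qC P c != 0 -> a = c.
Proof.
move=> gabc qBb qCc; apply/eqP; apply: contraTT isT => neq_ac.
have := teleport_point a c; rewrite eq_sym (negPf neq_ac) mulr0 => /eqP.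
rewrite psumr_eq0 => [/allP/(_ b (mem_index_enum b))|b' _].
  by rewrite gabc mul1r mulf_eq0 (negPf qBb) (negPf qCc).
by rewrite !mulr_ge0 ?ler0n ?(qB_distr P).1 ?(qC_distr P).1.
Qed.

(** At [c = a] the sum in [teleport_point] equals [ptele P > 0], so some term is nonzero, and then
    so is each of its factors. *)
Lemma postsel_diag (a : X) :
  qC P a != 0 /\ exists b : resource P, (qB b != 0) && postsel a b a.
Proof.
have /eqP : \sum_(b : resource P) (postsel a b a)%:R * qB b * qC P a <> 0.
  rewrite teleport_point eqxx mulr1 => p0.
  by have := ptele_itv P; rewrite p0 ltxx.
rewrite psumr_neq0 => [/hasP[b _]|b _].
  case: (postsel a b a) / idP => gaba /=; last by rewrite !mul0r ltxx.
  rewrite mul1r => /lt0r_neq0; rewrite mulf_eq0 negb_or => /andP[qBb qCa].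
  by split=> //; exists b; rewrite qBb gaba.
by rewrite !mulr_ge0 ?ler0n ?(qB_distr P).1 ?(qC_distr P).1.
Qed.

End Protocol.

Section Support.
Context {R : realFieldType} {V : finType} {E : rel V} {M : fcm R E}.

Definition realizes (x : assignment M) (u : errors M) : bool :=
  [forall v, (errp (u v) != 0) && (x v == fn (restrict_pa x v) (u v))].

Lemma errp_ge0 v (e : err M v) : 0 <= errp e.
Proof. exact: (errp_distr M v).1. Qed.

Lemma realizesE x u :
  realizes x u =
  (\prod_(v : V) (errp (u v) * (x v == fn (restrict_pa x v) (u v))%:R) != 0).
Proof.
apply/forallP/prodf_neq0 => [xu v _|xu v].
  by have /andP[e_neq0 ->] := xu v; rewrite mulr1.
by have := xu v isT; rewrite mulf_eq0 negb_or pnatr_eq0 eqb0 negbK.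
Qed.

Lemma acyc_prob_ge0 (x : assignment M) : 0 <= acyc_prob x.
Proof.
by apply: sumr_ge0 => u _; apply: prodr_ge0 => v _; rewrite mulr_ge0 ?errp_ge0.
Qed.

Lemma acyc_prob_neq0 (x : assignment M) :
  (acyc_prob x != 0) = [exists u : errors M, realizes x u].
Proof.
have term_ge0 (u : errors M) :
    0 <= \prod_(v : V) (errp (u v) * (x v == fn (restrict_pa x v) (u v))%:R).
  by apply: prodr_ge0 => v _; rewrite mulr_ge0 ?errp_ge0.
rewrite /acyc_prob psumr_neq0 // -big_has big_orE.
by apply: eq_existsb => u; rewrite realizesE lt0r term_ge0 andbT.
Qed.

(** Exchanging the sums over [x] and [u] shows that the formula [acyc_prob], read on the possibly
    cyclic graph, has total mass the average number of solutions. Both sides of the theorem thus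
    become sums of [acyc_prob]. *)
Lemma avg_solutions_acyc :
  avg_solutions M = \sum_(x : assignment M) acyc_prob x.
Proof.
rewrite exchange_big; apply: eq_bigr => u _.
rewrite natr_sum mulr_suml; apply: eq_bigr => x _.
rewrite natr_prod -big_split; apply: eq_bigr => v _ /=.
by rewrite mulrC eq_sym.
Qed.

Lemma sum_acyc_prob_neq0 (A : pred (assignment M)) :
  reflect (exists x u, A x /\ realizes x u)
          (\sum_(x | A x) acyc_prob x != 0).
Proof.
rewrite psumr_neq0 => [|x _]; last exact: acyc_prob_ge0.
apply: (iffP hasP) => [[x _ /andP[Ax]]|[x [u [Ax xu]]]].
  by move/lt0r_neq0; rewrite acyc_prob_neq0 => /existsP[u xu]; exists x, u.
exists x; rewrite ?mem_index_enum // Ax lt0r acyc_prob_ge0 acyc_prob_neq0 andbT.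
by apply/existsP; exists u.
Qed.

End Support.

Section Teleportation.
Context {R : realFieldType} {V : finType} {E : rel V} {M : fcm R E}.
Variable T : tele_model M.
Let S := splits T.

Lemma tele_input_restrict (x : assignment M) (y : assignment (tele_fcm T)) v :
    (forall w, y (inl w) = x w) ->
    (forall s : split_vertex S, y (inr (inl s)) = x (val s)) ->
  [ffun w : parent E v =>
     tele_input (restrict_pa y (inl v : tele_vertex S)) w] = restrict_pa x v.
Proof.
move=> y_orig y_pre; apply/ffunP => w; rewrite !ffunE /tele_input.
(* The case analysis is on the evidence itself, since each branch of [tele_input] builds a parent
   from the membership proof. *)
set d := boolP _; destruct d; rewrite [LHS]ffunE.
  exact: (y_pre (exist _ _ _)).
exact: y_orig.
Qed.

Lemma success_of_solution (x : assignment M) (u : errors M) :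
    realizes x u ->
  exists (y : assignment (tele_fcm T)) (e : errors (tele_fcm T)),
    [forall s : split_vertex S, y (inr (inr s)) == true] /\ realizes y e.
Proof.
move=> /forallP xu.
(* A resource value of positive weight for which [Post s] accepts the equal inputs [x (val s)]. *)
pose res (s : split_vertex S) :=
  xchoose (postsel_diag (protocol s) (x (val s))).2.
pose y : assignment (tele_fcm T) :=
  [ffun a : tele_vertex S =>
     match a return tele_obs (T := T) a with
     | inl v => x v
     | inr (inl s) => x (val s)
     | inr (inr s) => true
     end].
pose e : errors (tele_fcm T) :=
  [ffun a : tele_vertex S =>
     match a return tele_err (T := T) a with
     | inl v => u v
     | inr (inl s) => x (val s)
     | inr (inr s) => res s
     end].
exists y, e; split; first by apply/forallP => s; rewrite ffunE.
apply/forallP => -[v|[s|s]]; rewrite !ffunE /=.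
- by rewrite (@tele_input_restrict x) // => [w|s]; rewrite ffunE.
- by rewrite (postsel_diag _ _).1 eqxx.
- rewrite !ffunE /= /res.
  by case/andP: (xchooseP (postsel_diag (protocol s) (x (val s))).2) => -> ->.
Qed.

Lemma solution_of_success (y : assignment (tele_fcm T))
    (e : errors (tele_fcm T)) :
    [forall s : split_vertex S, y (inr (inr s)) == true] -> realizes y e ->
  exists (x : assignment M) (u : errors M), realizes x u.
Proof.
move=> /forallP y_succ /forallP ye.
exists [ffun v => y (inl v)], [ffun v => e (inl v)].
(* [Pre s] outputs its own error, so its value has nonzero [qC] weight, and [postsel_eq] applies to
   the accepting [Post s]. *)
have y_pre (s : split_vertex S) : y (inr (inl s)) = y (inl (val s)).
  have /= /andP[qCs /eqP y_pre_e] := ye (inr (inl s)).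
  have /= /andP[qBs /eqP] := ye (inr (inr s)).
  rewrite (eqP (y_succ s)) !ffunE /= => /esym y_post.
  by apply/esym/(postsel_eq _ _ _ _ y_post qBs); rewrite y_pre_e.
apply/forallP => v; rewrite !ffunE.
have := ye (inl v); rewrite /= (@tele_input_restrict [ffun v => y (inl v)]) //.
  by move=> w; rewrite ffunE.
by move=> s; rewrite ffunE.
Qed.

End Teleportation.

Theorem corollary2 (R : realFieldType) (V : finType) (E : rel V)
  (M : fcm R E) (T : tele_model M) :
  inconsistent M T <-> avg_solutions M = 0.
Proof.
suff iff_neq0 : success_prob T != 0 <-> avg_solutions M != 0.
  rewrite /inconsistent; split=> /eqP p0; apply/eqP; apply: contraLR p0.
    by move/iff_neq0.
  by move/iff_neq0.
rewrite avg_solutions_acyc; split.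
  case/sum_acyc_prob_neq0 => y [e [y_succ ye]]; apply/sum_acyc_prob_neq0.
  by have [x [u xu]] := solution_of_success T y e y_succ ye; exists x, u.
case/sum_acyc_prob_neq0 => x [u [_ xu]]; apply/sum_acyc_prob_neq0.
exact: success_of_solution T x u xu.
Qed.
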